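(* Let $f$ be differentiable, not necessarily convex, on $\mathcal{X}=\mathcal{X}_1\times\cdots\times\mathcal{X}_{N_b}$, let $\alpha=B/N_b$, and let $\{\mathbf{x}^t\}$ be the iterates of the randomized block Frank-Wolfe algorithm in which the step sizes are chosen by exact line search, $$\gamma_t\in\arg\min_{0\le\gamma\le 1} f\big((1-\gamma)\mathbf{x}^t+\gamma\hat{\mathbf{s}}^t\big),$$ where $\hat{\mathbf{s}}^t=(\hat{\mathbf{s}}^t_1,\ldots,\hat{\mathbf{s}}^t_{N_b})$ with $\hat{\mathbf{s}}_n^t=\mathbf{s}_n^t$ for $n\in\mathcal{B}_t$ and $\hat{\mathbf{s}}_n^t=\mathbf{x}_n^t$ for $n\in\mathcal{N}_b\setminus\mathcal{B}_t$. Then for all $t\ge 0$, $$g_t\le \frac{\max\left\{2h(\mathbf{x}^0),\ \bar C_f^{B}\right\}}{\alpha\sqrt{t+1}},$$ where $g_t:=\min_{k\in\{0,1,\ldots,t\}}\mathbb{E}[g(\mathbf{x}^k)]$.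
   Context: Setting. $N_b\ge 1$ is an integer, $\mathcal{N}_b=\{1,\ldots,N_b\}$, $B\in\{1,\ldots,N_b\}$, $\alpha:=B/N_b$. Vectors $\mathbf{x}\in\mathbb{R}^d$ are split into blocks $\mathbf{x}=(\mathbf{x}_1,\ldots,\mathbf{x}_{N_b})$. The feasible set is $\mathcal{X}=\mathcal{X}_1\times\cdots\times\mathcal{X}_{N_b}$, with each $\mathcal{X}_n$ nonempty, convex and compact. The objective $f$ is real-valued and differentiable on (an open set containing) $\mathcal{X}$; $\nabla_{\mathbf{x}_n}f$ denotes the partial gradient with respect to block $n$. The problem is to minimize $f$ over $\mathcal{X}$; $\mathbf{x}^*$ is a global minimizer of $f$ over $\mathcal{X}$, and $h(\mathbf{x}):=f(\mathbf{x})-f(\mathbf{x}^* )$. The duality gap (a measure of non-stationarity) is $g(\mathbf{x}):=\sup_{\mathbf{s}\in\mathcal{X}}(\mathbf{x}-\mathbf{s})^\top\nabla f(\mathbf{x})$ for $\mathbf{x}\in\mathcal{X}$. Randomized block Frank-Wolfe algorithm. Start from a (deterministic) $\mathbf{x}^0\in\mathcal{X}$. At iteration $t=0,1,\ldots$: draw $\mathcal{B}_t$ uniformly at random among all subsets of $\mathcal{N}_b$ with exactly $B$ elements, independently of previous draws; for each $n\in\mathcal{B}_t$ pick a minimizer $\mathbf{s}_n^t\in\arg\min_{\mathbf{s}_n\in\mathcal{X}_n}\langle \mathbf{s}_n,\nabla_{\mathbf{x}_n}f(\mathbf{x}^t)\rangle$; choose the step size $\gamma_t$ (here by the line search stated in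 the claim); set $\mathbf{x}_n^{t+1}=(1-\gamma_t)\mathbf{x}_n^t+\gamma_t\mathbf{s}_n^t$ for $n\in\mathcal{B}_t$ and $\mathbf{x}_n^{t+1}=\mathbf{x}_n^t$ for $n\notin\mathcal{B}_t$. Ties in either arg min are broken arbitrarily, as a function of the draws $\mathcal{B}_0,\ldots,\mathcal{B}_t$. Expectations are over the random draws. Curvature. For $\mathcal{B}\subseteq\mathcal{N}_b$, $$C_f^{\mathcal{B}}:=\sup \frac{2}{\gamma^2}\Big(f(\mathbf{y})-f(\mathbf{x})-\sum_{n\in\mathcal{B}}\langle\mathbf{y}_n-\mathbf{x}_n,\nabla_{\mathbf{x}_n}f(\mathbf{x})\rangle\Big),$$ the supremum being over $\gamma\in(0,1]$, $\mathbf{x}\in\mathcal{X}$, $\mathbf{s}_n\in\mathcal{X}_n$ ($n\in\mathcal{B}$), where $\mathbf{y}_n=(1-\gamma)\mathbf{x}_n+\gamma\mathbf{s}_n$ for $n\in\mathcal{B}$ and $\mathbf{y}_n=\mathbf{x}_n$ otherwise. The expected set curvature is $\bar C_f^{B}:=\binom{N_b}{B}^{-1}\sum_{\mathcal{B}\subseteq\mathcal{N}_b,\,|\mathcal{B}|=B}C_f^{\mathcal{B}}$. It is assumed throughout that $C_f:=C_f^{\mathcal{N}_b}$ is finite (hence so are all $C_f^{\mathcal{B}}$ and $\bar C_f^{B}$). *)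

(* Defs.v *)
From HB Require Import structures.
From mathcomp Require Import all_boot all_order all_algebra.
From mathcomp Require Import all_classical all_reals all_analysis.

Set Implicit Arguments.
Unset Strict Implicit.
Unset Printing Implicit Defensive.

Import Order.TTheory GRing.Theory Num.Theory.
Import numFieldNormedType.Exports.

Local Open Scope classical_set_scope.
Local Open Scope ring_scope.

(* A point of R^d with d = \sum_n dim n is a row vector, and [submxrow x n] is
   its n-th block. Block indices are 'I_N = {0, ..., N - 1}. *)
Section BlockFrankWolfe.
Context {R : realType} {N : nat} {dim : 'I_N -> nat}.
Notation vec := 'rV[R]_(\sum_n dim n).
Notation blocks := (forall n : 'I_N, 'rV[R]_(dim n)).
Implicit Types (X : forall n : 'I_N, set 'rV[R]_(dim n)) (f : vec -> R).
Implicit Types (x : vec) (s : blocks) (S : {set 'I_N}) (gamma : R).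

Definition dotv m (u v : 'rV[R]_m) : R := \sum_i u 0 i * v 0 i.

Definition grad m (f : 'rV[R]_m -> R) (x : 'rV[R]_m) : 'rV[R]_m :=
  \row_i 'D_(delta_mx 0 i) f x.

Definition partial_grad f x (n : 'I_N) : 'rV[R]_(dim n) :=
  submxrow (grad f x) n.

Definition feasible X : set vec := [set x | forall n, X n (submxrow x n)].

Definition block_step S gamma x s : vec :=
  \mxrow_n (if n \in S then (1 - gamma) *: submxrow x n + gamma *: s n
            else submxrow x n).

Definition fill_blocks S x s : vec :=
  \mxrow_n (if n \in S then s n else submxrow x n).

(* A supremum in \bar R, so that finiteness of the curvature is a genuine
   hypothesis. The blocks s n with n \notin S are not used. *)
Definition set_curvature X f S : \bar R :=
  ereal_sup [set c | exists gamma x s,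
    [/\ 0 < gamma, gamma <= 1, feasible X x,
        (forall n, n \in S -> X n (s n)) &
        let y := block_step S gamma x s in
        c = (2 / gamma ^+ 2 *
             (f y - f x - \sum_(n in S)
                dotv (submxrow y n - submxrow x n) (partial_grad f x n)))%:E]].

Definition expected_set_curvature X f (B : nat) : \bar R :=
  (('C(N, B)%:R^-1)%:E *
   \sum_(S : {set 'I_N} | #|S| == B) set_curvature X f S)%E.

(* The supremum is taken in R; on a nonempty compact feasible set it is that of
   a nonempty bounded set. *)
Definition duality_gap X f x : R :=
  sup [set dotv (x - s) (grad f x) | s in feasible X].

Section Random.
Context {disp : measure_display} {T : measurableType disp}.
Variable P : probability T R.
Implicit Types draw : nat -> T -> {set 'I_N}.

Definition uniform_draws draw (B : nat) : Prop :=
  forall t S, measurable [set w | draw t w = S] /\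
    P [set w | draw t w = S] = (if #|S| == B then 'C(N, B)%:R^-1 else 0)%:E.

Definition independent_draws draw : Prop :=
  forall (J : seq nat) (A : nat -> set {set 'I_N}), uniq J ->
    P (\bigcap_(t in [set` J]) draw t @^-1` A t) =
    (\prod_(t <- J) P (draw t @^-1` A t))%E.

Definition history draw (t : nat) (w : T) : seq {set 'I_N} :=
  [seq draw k w | k <- iota 0 t.+1].

(* [s t w n] is relevant only for n \in draw t w. Ties are broken as functions
   of the draws of rounds 0, ..., t. *)
Record block_frank_wolfe X f (x0 : vec) draw (s : nat -> T -> blocks)
    (gamma : nat -> T -> R) (x : nat -> T -> vec) : Prop := BlockFrankWolfe {
  bfw_init : forall w, x 0%N w = x0 ;
  bfw_oracle : forall t w n, n \in draw t w ->
    X n (s t w n) /\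
    forall z, X n z -> dotv (s t w n) (partial_grad f (x t w) n) <=
                       dotv z (partial_grad f (x t w) n) ;
  bfw_oracle_ties : forall t, exists sel : seq {set 'I_N} -> blocks,
    forall w n, n \in draw t w -> s t w n = sel (history draw t w) n ;
  bfw_search : forall t w,
    let sh := fill_blocks (draw t w) (x t w) (s t w) in
    0 <= gamma t w <= 1 /\
    forall eta, 0 <= eta <= 1 ->
      f ((1 - gamma t w) *: x t w + gamma t w *: sh) <=
      f ((1 - eta) *: x t w + eta *: sh) ;
  bfw_search_ties : forall t, exists sel : seq {set 'I_N} -> R,
    forall w, gamma t w = sel (history draw t w) ;
  bfw_update : forall t w,
    x t.+1 w = block_step (draw t w) (gamma t w) (x t w) (s t w) }.

End Random.
End BlockFrankWolfe.

(* Main.v *)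
(** A step of fixed size [eta] in the drawn blocks is never better than the line
    search, so the curvature bound gives, for every realization,
    [f x_(k+1) <= f x_k - eta * (gap of the blocks in B_k) + eta^2 / 2 * C^(B_k)].
    The draw [B_k] is independent of [x_k] and contains each block with
    probability [alpha]; averaging, [E f x_(k+1) <= E f x_k - eta alpha E g(x_k) +
    eta^2 / 2 * Cbar]. Summing over [k <= t] with [eta = 1 / sqrt (t+1)] yields
    [min_k E g(x_k) <= (h(x_0) + Cbar / 2) / (alpha sqrt (t+1))], and
    [h(x_0) + Cbar / 2 <= max (2 h(x_0), Cbar)]. *)

Require Import Defs.
From HB Require Import structures.
From mathcomp Require Import all_boot all_order all_algebra.
From mathcomp Require Import all_classical all_reals all_analysis.
From mathcomp Require Import ring lra.

Set Implicit Arguments.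
Unset Strict Implicit.
Unset Printing Implicit Defensive.

Import Order.TTheory GRing.Theory Num.Theory.
Import numFieldNormedType.Exports.
Local Open Scope classical_set_scope.
Local Open Scope ring_scope.

(** Only rounds before [t] are listed, those that determine the iterate [x t]. The latest comes
    first, so that a new round is a [cons]. *)
Fixpoint past {N : nat} {T : Type} (draw : nat -> T -> {set 'I_N}) (t : nat) (w : T)
    : seq {set 'I_N} :=
  if t is k.+1 then draw k w :: past draw k w else [::].

(* The expectation of [F] applied to the first [t] draws, when these are
   independent with law [u]. *)
Definition avg {R : realType} {N : nat} (u : {set 'I_N} -> R) (t : nat)
    (F : seq {set 'I_N} -> R) : R :=
  \sum_(l : t.-tuple {set 'I_N}) (\prod_(A <- l) u A) * F l.

(* The [k]-th draw of the history [l], in which the most recent draw comes first. *)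
Fixpoint draw_at {N : nat} (l : seq {set 'I_N}) (k : nat) : {set 'I_N} :=
  if l is A :: l' then if k == size l' then A else draw_at l' k else finset.set0.

(** * Law of the draw history, and expectations as finite averages *)

Section Draws.
Context {R : realType} {N : nat} {disp : measure_display}.
Context {T : measurableType disp} {P : probability T R}.
Context {draw : nat -> T -> {set 'I_N}} {u : {set 'I_N} -> R}.

Lemma size_past t w : size (past draw t w) = t.
Proof. by elim: t => //= t ->. Qed.

Lemma past_history t w : past draw t.+1 w = rev (history draw t w).
Proof.
elim: t => [|t IH]; first by [].
by rewrite /history -[X in iota _ X]addn1 iotaD map_cat rev_cat -/(history _ _ _) -IH.
Qed.

(** Turns a prescribed history into finitely many conditions on single draws, the shape in which
    [independent_draws] yields a product. *)
Lemma pastP l w :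
  past draw (size l) w = l <-> forall k, (k < size l)%N -> draw k w = draw_at l k.
Proof.
elim: l => [|A l IH] /=; first by split.
split=> [[Sw lw] k|H].
- rewrite ltnS leq_eqVlt; case: eqVneq => [-> //|_ /= kl].
  by move/IH: lw; apply.
- rewrite H // eqxx; congr cons; apply/IH => k kl.
  by rewrite H ?ltnS ?(ltnW kl) // ltn_eqF.
Qed.

Lemma prod_draw_at l : \prod_(k <- iota 0 (size l)) u (draw_at l k) = \prod_(A <- l) u A.
Proof.
elim: l => [|A l IH]; first by rewrite !big_nil.
rewrite [size _]/= -addn1 iotaD big_cat big_cons -IH mulrC /=.
rewrite big_cons big_nil mulr1 eqxx; congr (_ * _).
rewrite big_seq [RHS]big_seq; apply: eq_bigr => k.
by rewrite mem_iota add0n => kl; rewrite ltn_eqF.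
Qed.

Lemma avg0 F : avg u 0 F = F [::].
Proof.
rewrite /avg (big_pred1 [tuple]) ?big_nil ?mul1r // => l.
by rewrite (tuple0 l) /= eqxx.
Qed.

(** Fubini for the product law: a tuple is its head and its tail, so the latest draw is summed out
    with the earlier history fixed. *)
Lemma avgS t F : avg u t.+1 F = avg u t (fun l => \sum_A u A * F (A :: l)).
Proof.
rewrite /avg; under [RHS]eq_bigr do rewrite big_distrr.
rewrite exchange_big /= pair_bigA /=.
rewrite (reindex (fun p : {set 'I_N} * t.-tuple {set 'I_N} => [tuple of p.1 :: p.2])) /=.
  by apply: eq_bigr => -[A l] _; rewrite big_cons mulrA [u A * _]mulrC.
exists (fun l => (thead l, [tuple of behead l])) => [[A l] _|l _] /=.
  by rewrite theadE; congr pair; apply/val_inj.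
by rewrite [RHS]tuple_eta; apply/val_inj.
Qed.

Hypothesis draw_dist : forall t A, measurable [set w | draw t w = A] /\
  P [set w | draw t w = A] = (u A)%:E.
Hypothesis draw_indep : independent_draws P draw.

Let draw_measurable t A : measurable [set w | draw t w = A].
Proof. by case: (draw_dist t A). Qed.

Lemma measurable_past t l : measurable [set w | past draw t w = l].
Proof.
elim: t l => [|t IH] [|A l] /=.
- rewrite (_ : mkset _ = setT) //.
  by apply/seteqP; split.
- rewrite (_ : mkset _ = set0) //.
  by apply/seteqP; split.
- rewrite (_ : mkset _ = set0) //.
  by apply/seteqP; split.
rewrite (_ : mkset _ = [set w | draw t w = A] `&` [set w | past draw t w = l]).
  exact: measurableI.
by apply/seteqP; split => w /= [-> ->].
Qed.

Lemma past_dist l :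
  P [set w | past draw (size l) w = l] = (\prod_(A <- l) u A)%:E.
Proof.
have -> : [set w | past draw (size l) w = l] =
    \bigcap_(k in [set` iota 0 (size l)]) draw k @^-1` [set draw_at l k].
  by apply/seteqP; split => w /= => [/pastP H k|H]; [|apply/pastP => k kl; apply: H];
    rewrite /= mem_iota // => /H.
rewrite (@draw_indep _ (fun k => [set draw_at l k])) ?iota_uniq // -prod_draw_at -prodEFin.
by apply: eq_bigr => k _; case: (draw_dist k (draw_at l k)).
Qed.

Lemma prob_past t (l : t.-tuple {set 'I_N}) :
  P [set w | past draw t w = l] = (\prod_(A <- l) u A)%:E.
Proof. by rewrite -past_dist size_tuple. Qed.

(** Sample-path bounds speak of realized histories only. A tuple that no [w] realizes has an empty
    event, so by [prob_past] its weight is zero. *)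
Lemma avg_le t F G : (forall w, F (past draw t w) <= G (past draw t w)) ->
  avg u t F <= avg u t G.
Proof.
move=> FG; apply: ler_sum => l _.
have [[w wl]|nl] := pselect (exists w, past draw t w = l).
  rewrite ler_wpM2l -?wl // -lee_fin wl -prob_past; exact: measure_ge0.
have : P [set w | past draw t w = l] = 0%E.
  rewrite (_ : mkset _ = set0) ?measure0 //.
  by apply/seteqP; split => // w wl; apply: nl; exists w.
by rewrite prob_past => -[->]; rewrite !mul0r.
Qed.

(** Exactly one tuple matches each [w], so the integrand is a finite combination of indicators of
    the events [E l]. *)
Lemma expectation_past t F : ('E_P[fun w => F (past draw t w)] = (avg u t F)%:E)%E.
Proof.
pose E (l : t.-tuple {set 'I_N}) := [set w | past draw t w = l].
rewrite unlock /avg -sumEFin.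
have -> : (\int[P]_w (F (past draw t w))%:E =
    \int[P]_w \sum_(l : t.-tuple {set 'I_N}) (F l)%:E * (\1_(E l) w)%:E)%E.
  apply: eq_integral => w _.
  have sz : size (past draw t w) == t by rewrite size_past.
  rewrite (bigD1 (Tuple sz)) //= indicE mem_set // mule1 big1 ?adde0 // => l.
  move=> /eqP lw; rewrite indicE memNset ?mule0 // => wl; apply: lw.
  by apply/val_inj.
have intE l : P.-integrable setT (fun w => (\1_(E l) w)%:E).
  by apply: integrable_indic; exact: measurable_past.
rewrite integral_sum //; last by move=> l; exact: integrableZl.
apply: eq_bigr => l _; rewrite integralZl // integral_indic // ?setIT; last first.
  exact: measurable_past.
by rewrite mulrC EFinM; congr (_ * _)%E; exact: prob_past.
Qed.

Lemma avg_cst t (c : R) : avg u t (fun=> c) = c.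
Proof.
by apply: EFin_inj; rewrite -(expectation_past t (fun=> c)) expectation_cst.
Qed.

Lemma avgD t F G : avg u t (fun l => F l + G l) = avg u t F + avg u t G.
Proof. by rewrite /avg -big_split; apply: eq_bigr => l _; rewrite mulrDr. Qed.

Lemma avgZ t (c : R) F : avg u t (fun l => c * F l) = c * avg u t F.
Proof. by rewrite /avg mulr_sumr; apply: eq_bigr => l _; rewrite mulrCA. Qed.

End Draws.

(** * Counting the sets of drawn blocks *)

Section Weights.
Context {R : realType} {N : nat}.
Variable B : nat.

Definition unif (S : {set 'I_N}) : R := if #|S| == B then 'C(N, B)%:R^-1 else 0.

Lemma card_draws_mem (n : 'I_N) : (0 < B)%N ->
  #|[set S : {set 'I_N} | (#|S| == B) && (n \in S)]%SET| = 'C(N.-1, B.-1).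
Proof.
case: B => // b _; case: N n => [[] //|m] n /=.
pose D := [set S : {set 'I_m.+1} | #|S| == b.+1]%SET.
have cD : #|D| = 'C(m.+1, b.+1).
  by rewrite card_draws card_ord.
(* Count the sets avoiding [n] instead, and use Pascal's rule. *)
pose C := [set S : {set 'I_m.+1} | S \subset [set~ n]%SET & #|S| == b.+1]%SET.
have cC : #|C| = 'C(m, b.+1).
  by rewrite cards_draws cardsC1 card_ord.
have := cardsID [set S : {set 'I_m.+1} | n \in S]%SET D.
rewrite cD binS addnC -cC (_ : (D :\: _)%SET = C); last first.
  by apply/setP => S; rewrite !inE finset.subsetC finset.sub1set inE.
move/addnI => <-; apply: eq_card => S; rewrite !inE //.
Qed.

Lemma sum_unif : (B <= N)%N -> \sum_S unif S = 1.
Proof.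
move=> BN; rewrite /unif -big_mkcond sumr_const.
rewrite (eq_card (_ : _ =i [set S : {set 'I_N} | #|S| == B]%SET)); last first.
  by move=> S; rewrite !inE.
by rewrite card_draws card_ord -[LHS]mulr_natr mulVf // pnatr_eq0 -lt0n bin_gt0.
Qed.

(** The count of [card_draws_mem] is divided by C(N, B) and simplified by N C(N-1, B-1) = B C(N,
    B). *)
Lemma sum_unif_mem n : (0 < B <= N)%N ->
  \sum_(S : {set 'I_N} | n \in S) unif S = B%:R / N%:R.
Proof.
move=> /andP[B0 BN]; rewrite /unif -big_mkcondr sumr_const.
rewrite (eq_card (_ : _ =i [set S : {set 'I_N} | (#|S| == B) && (n \in S)]%SET)); last first.
  by move=> S; rewrite !inE andbC.
rewrite card_draws_mem //.
have C0 : 'C(N, B)%:R != 0 :> R by rewrite pnatr_eq0 -lt0n bin_gt0.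
have N0 : N%:R != 0 :> R by rewrite pnatr_eq0 -lt0n (leq_trans B0).
apply: (mulfI C0); rewrite -[_^-1 *+ _]mulr_natr mulrA divff // mul1r.
apply: (mulIf N0); rewrite -[RHS]mulrA divfK // -!natrM mulnC mul_bin_diag.
by rewrite prednK // mulnC.
Qed.

(** After exchanging the sums, [a n] collects the weight of all sets containing [n]; this is the
    source of the factor alpha. *)
Lemma sum_unif_blocks (a : 'I_N -> R) : (0 < B <= N)%N ->
  \sum_S unif S * \sum_(n in S) a n = B%:R / N%:R * \sum_n a n.
Proof.
move=> hB; rewrite mulr_sumr.
under eq_bigr do rewrite mulr_sumr big_mkcond /=.
rewrite exchange_big; apply: eq_bigr => n _.
by rewrite -big_mkcond -mulr_suml sum_unif_mem.
Qed.

End Weights.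

(** * Inner products and their block decomposition *)

Section Dot.
Context {R : realType}.

Lemma dotvE m (a b : 'rV[R]_m) : dotv a b = (a *m b^T) 0 0.
Proof. by rewrite mxE; apply: eq_bigr => i _; rewrite mxE. Qed.

Lemma dotvZl m (c : R) (a b : 'rV[R]_m) : dotv (c *: a) b = c * dotv a b.
Proof. by rewrite !dotvE -scalemxAl mxE. Qed.

Lemma dotv0l m (b : 'rV[R]_m) : dotv 0 b = 0.
Proof. by rewrite dotvE mul0mx mxE. Qed.

Lemma dotvBl m (a b c : 'rV[R]_m) : dotv (a - b) c = dotv a c - dotv b c.
Proof. by rewrite !dotvE mulmxBl !mxE. Qed.

Lemma dotv_blocks N (dim : 'I_N -> nat) (a b : 'rV[R]_(\sum_n dim n)) :
  dotv a b = \sum_n dotv (submxrow a n) (submxrow b n).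
Proof.
rewrite dotvE -{1}[a]submxrowK -{1}[b]submxrowK tr_mxrow mul_mxrow_mxcol summxE.
by apply: eq_bigr => n _; rewrite dotvE.
Qed.

Lemma dotv_continuous m (b : 'rV[R]_m) : continuous (fun a : 'rV[R]_m => dotv a b).
Proof.
move=> a; apply: (continuous_big add_continuous) => i _ {}a.
by apply: (@continuousM _ _ (fun a0 : 'rV[R]_m => a0 0 i) (fun=> b 0 i));
  [exact: coord_continuous | exact: cst_continuous].
Qed.

End Dot.

(** * Curvature and gaps at a fixed point *)

Section Deterministic.
Context {R : realType} {N : nat} {dim : 'I_N -> nat}.
Variables (X : forall n, set 'rV[R]_(dim n)) (f : 'rV[R]_(\sum_n dim n) -> R).
Arguments X : clear implicits.
Notation vec := 'rV[R]_(\sum_n dim n).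
Implicit Types (x : vec) (s : forall n, 'rV[R]_(dim n)) (S : {set 'I_N}).

Lemma submxrowZ x (c : R) n : submxrow (c *: x) n = c *: submxrow x n.
Proof. by apply/rowP => j; rewrite !mxE. Qed.

(** Joins the update rule and the curvature, written with [block_step], to the line search, written
    with [fill_blocks]. *)
Lemma block_stepE S eta x s :
  block_step S eta x s = (1 - eta) *: x + eta *: fill_blocks S x s.
Proof.
apply/mxrowP => n; rewrite submxrowD !submxrowZ !mxrowK; case: ifP => // _.
by rewrite -scalerDl subrK scale1r.
Qed.

Lemma block_step_feasible S eta x s : (forall n, convex_set (X n)) ->
  0 <= eta <= 1 -> feasible X x -> (forall n, n \in S -> X n (s n)) ->
  feasible X (block_step S eta x s).
Proof.
move=> Xc etaI Xx Xs n; rewrite mxrowK; case: ifP => // nS.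
have := Xc n (s n) (submxrow x n) (Itv01 (andP etaI).1 (andP etaI).2).
rewrite !inE => /(_ (Xs _ nS) (Xx n)).
by rewrite addrC.
Qed.

(** The choice s = x moves nothing and contributes the value 0. With [set_curvature_le], this passes
    finiteness from the full set to every [S]. *)
Lemma set_curvature_ge0 S : feasible X !=set0 -> (0 <= set_curvature X f S)%E.
Proof.
move=> [x Xx]; apply: ereal_sup_ubound => /=.
exists 1, x, (fun n => submxrow x n); split; rewrite ?ltr01 ?lexx //.
have -> : block_step S 1 x (fun n => submxrow x n) = x.
  apply/mxrowP => n; rewrite mxrowK subrr scale0r add0r scale1r.
  by case: ifP.
rewrite subrr big1 ?subr0 ?mulr0 // => n _.
by rewrite subrr dotv0l.
Qed.

(** A step in [S] is a full step whose targets outside [S] are the current blocks; the extra terms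
    of the sum vanish. *)
Lemma set_curvature_le S :
  (set_curvature X f S <= set_curvature X f [set: 'I_N]%SET)%E.
Proof.
apply: ub_ereal_sup => _ /= [gamma [x [s [g0 g1 Xx Xs ->]]]].
apply: ereal_sup_ubound => /=.
exists gamma, x, (fun n => if n \in S then s n else submxrow x n); split => //.
  by move=> n _; case: ifP => [/Xs|_] //; exact: Xx.
set y := block_step S gamma x s.
have <- : y = block_step [set: 'I_N]%SET gamma x
    (fun n => if n \in S then s n else submxrow x n).
  apply/mxrowP => n; rewrite !mxrowK finset.in_setT; case: ifP => // _.
  by rewrite -scalerDl subrK scale1r.
congr ((_ * (_ - _))%:E); rewrite big_mkcond [RHS]big_mkcond.
apply: eq_bigr => n _; rewrite finset.in_setT mxrowK; case: ifP => [->//|_].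
by rewrite subrr dotv0l.
Qed.

Lemma set_curvature_fin S : feasible X !=set0 ->
  set_curvature X f [set: 'I_N]%SET \is a fin_num ->
  set_curvature X f S \is a fin_num.
Proof.
move=> X0 Cfin; rewrite ge0_fin_numE ?set_curvature_ge0 //.
by rewrite (le_lt_trans (set_curvature_le S)) // ltey_eq Cfin.
Qed.

Lemma expected_set_curvatureE B : feasible X !=set0 ->
  set_curvature X f [set: 'I_N]%SET \is a fin_num ->
  expected_set_curvature X f B =
  (\sum_S unif B S * fine (set_curvature X f S))%:E.
Proof.
move=> X0 Cfin; rewrite /expected_set_curvature.
under eq_bigr do rewrite -(fineK (set_curvature_fin _ X0 Cfin)).
rewrite sumEFin -EFinM mulr_sumr big_mkcond; congr EFin; apply: eq_bigr => S _.
by rewrite /unif; case: ifP; rewrite ?mul0r.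
Qed.

Lemma curvature_descent S eta x s (c : R) : 0 < eta -> eta <= 1 ->
  feasible X x -> (forall n, n \in S -> X n (s n)) ->
  (set_curvature X f S <= c%:E)%E ->
  f (block_step S eta x s) <= f x
    - eta * (\sum_(n in S) dotv (submxrow x n - s n) (partial_grad f x n))
    + eta ^+ 2 / 2 * c.
Proof.
move=> eta0 eta1 Xx Xs Cc.
set y := block_step S eta x s.
have : 2 / eta ^+ 2 * (f y - f x - \sum_(n in S)
    dotv (submxrow y n - submxrow x n) (partial_grad f x n)) <= c.
  rewrite -lee_fin; apply: le_trans Cc; apply: ereal_sup_ubound => /=.
  by exists eta, x, s.
have -> : \sum_(n in S) dotv (submxrow y n - submxrow x n) (partial_grad f x n) =
    - (eta * \sum_(n in S) dotv (submxrow x n - s n) (partial_grad f x n)).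
  rewrite mulr_sumr -sumrN; apply: eq_bigr => n nS.
  rewrite mxrowK nS -mulNr -dotvZl; congr dotv.
  by rewrite scalerBl scale1r scalerBr !scaleNr opprK addrAC [submxrow x n - _]addrC addrK.
rewrite opprK mulrC -ler_pdivlMr ?divr_gt0 ?exprn_gt0 // invf_div => yc.
lra.
Qed.

(** Depends on the point alone, whereas the oracle answers may vary with the current draw; hence it
    can be averaged against that draw. *)
Definition block_gap x n : R :=
  sup [set dotv (submxrow x n - z) (partial_grad f x n) | z in X n].

(** A linear form attains its minimum on the compact [X n], so the real [sup] is taken over a
    bounded set. *)
Lemma block_gap_ub x n z : compact (X n) -> X n z ->
  dotv (submxrow x n - z) (partial_grad f x n) <= block_gap x n.
Proof.
move=> Xcomp Xz; apply: ub_le_sup; last by exists z.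
have Xn0 : X n !=set0 by exists z.
have cont : {within X n, continuous (fun a => dotv a (partial_grad f x n))}.
  by apply: continuous_subspaceT; exact: dotv_continuous.
have [c _ cmin] := EVT_min_rV Xn0 Xcomp cont.
exists (dotv (submxrow x n - c) (partial_grad f x n)) => _ /= [a Xa <-].
by rewrite !dotvBl lerB // cmin // inE.
Qed.

Lemma block_gap_le x n s : X n !=set0 ->
  (forall z, X n z -> dotv (s n) (partial_grad f x n) <= dotv z (partial_grad f x n)) ->
  block_gap x n <= dotv (submxrow x n - s n) (partial_grad f x n).
Proof.
move=> [z0 Xz0] smin; apply: ge_sup.
  by exists (dotv (submxrow x n - z0) (partial_grad f x n)), z0.
by move=> _ /= [z Xz <-]; rewrite !dotvBl lerB // smin.
Qed.

Lemma duality_gap_le x : (forall n, compact (X n)) -> feasible X !=set0 ->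
  duality_gap X f x <= \sum_n block_gap x n.
Proof.
move=> Xcomp [z0 Xz0]; apply: ge_sup.
  by exists (dotv (x - z0) (grad f x)), z0.
move=> _ /= [z Xz <-]; rewrite dotv_blocks; apply: ler_sum => n _.
by rewrite submxrowB; exact: block_gap_ub.
Qed.

End Deterministic.

(** By contradiction: with step 1/sqrt(t+1), gaps all above the bound would make [a] fall by more
    than M - C/2 over t+1 rounds, M being the maximum. As M is at least the mean of 2(a 0 - fmin)
    and C, this exceeds a 0 - fmin. *)
Lemma min_gap_bound {R : realType} (a G : nat -> R) (alpha C fmin : R) (t : nat) :
  0 < alpha ->
  (forall k eta, 0 < eta -> eta <= 1 ->
    a k.+1 <= a k - eta * (alpha * G k) + eta ^+ 2 / 2 * C) ->
  fmin <= a t.+1 ->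
  exists k : 'I_t.+1,
    G k <= Num.max (2 * (a 0%N - fmin)) C * (alpha * Num.sqrt t.+1%:R)^-1.
Proof.
move=> alpha0 desc amin.
set M := Num.max _ _; set r := Num.sqrt _.
have r0 : 0 < r by rewrite sqrtr_gt0 ltr0n.
have r1 : 1 <= r by rewrite -[leLHS]sqrtr1 ler_sqrt ?ltr0n // ler1n.
have r2 : r ^+ 2 = t.+1%:R by rewrite sqr_sqrtr.
have [//|noG] := pselect (exists k : 'I_t.+1, G k <= M * (alpha * r)^-1).
have step k : (k < t.+1)%N -> a k.+1 < a k - (M - C / 2) / t.+1%:R.
  move=> kt; have Gk : M * (alpha * r)^-1 < G k.
    by rewrite ltNge; apply/negP => Gk; apply: noG; exists (Ordinal kt).
  have D : a k.+1 <= a k - r^-1 * (alpha * G k) + r^-1 ^+ 2 / 2 * C.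
    by apply: desc; rewrite ?invr_gt0 ?invf_le1.
  apply: le_lt_trans D _.
  have : r^-1 * (alpha * (M * (alpha * r)^-1)) < r^-1 * (alpha * G k).
    by rewrite ltr_pM2l ?invr_gt0 // ltr_pM2l.
  have -> : r^-1 * (alpha * (M * (alpha * r)^-1)) = M / t.+1%:R.
    by rewrite -r2; field; rewrite !gt_eqF.
  rewrite exprVn r2 [_ / 2 * C]mulrAC [_ * C]mulrC [C * _ / 2]mulrAC mulrBl.
  by move: (M / _) (C / 2 / _) (r^-1 * _) => p q e; lra.
move: step; set d := (M - C / 2) / t.+1%:R => step.
(* Non-strict, to include k = 0; strictness returns with the last step, [step t]. *)
have acc k : (k <= t)%N -> a k <= a 0%N - k%:R * d.
  elim: k => [|k IH] kt; first by rewrite mul0r subr0.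
  have := IH (ltnW kt); have := step k (ltnW kt).
  by rewrite -natr1 mulrDl mul1r; lra.
have := acc t (leqnn _); have := step t (ltnSn _).
have : (t%:R + 1) * d = M - C / 2 by rewrite natr1 mulrC divfK.
rewrite mulrDl mul1r.
have : 2 * (a 0%N - fmin) <= M by rewrite le_max lexx.
have : C <= M by rewrite le_max lexx orbT.
lra.
Qed.

(** * The iterates along a sample path *)

Section Iterates.
Context {R : realType} {N : nat} {dim : 'I_N -> nat}.
Context {disp : measure_display} {T : measurableType disp}.
Variables (X : forall n, set 'rV[R]_(dim n)) (f : 'rV[R]_(\sum_n dim n) -> R).
Arguments X : clear implicits.
Variables (x0 : 'rV[R]_(\sum_n dim n)) (draw : nat -> T -> {set 'I_N}).
Variables (s : nat -> T -> forall n, 'rV[R]_(dim n)) (gamma : nat -> T -> R).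
Variable (x : nat -> T -> 'rV[R]_(\sum_n dim n)).
Hypothesis bfw : block_frank_wolfe X f x0 draw s gamma x.
Hypothesis Xconv : forall n, convex_set (X n).
Hypothesis Xx0 : feasible X x0.

Lemma iterate_feasible t w : feasible X (x t w).
Proof.
elim: t => [|t IH]; first by rewrite (bfw_init bfw).
rewrite (bfw_update bfw); apply: block_step_feasible => //.
  by case: (bfw_search bfw t w).
by move=> n /(bfw_oracle bfw)[].
Qed.

(** By induction, as both tie-breaking rules read only the draws made so far. This replaces
    conditioning on the past: [phi l] stays fixed while the next draw varies. *)
Lemma iterate_past : exists phi : seq {set 'I_N} -> 'rV[R]_(\sum_n dim n),
  forall t w, x t w = phi (past draw t w).
Proof.
suff /choice[phi phiE] : forall t, exists phi : seq {set 'I_N} -> 'rV[R]_(\sum_n dim n),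
    forall w, x t w = phi (past draw t w).
  (* The length of the history recovers [t], so a single function serves all rounds. *)
  by exists (fun l => phi (size l) l) => t w; rewrite size_past.
elim=> [|t [phi phiE]]; first by exists (fun=> x0) => w; rewrite (bfw_init bfw).
have [ssel sE] := bfw_oracle_ties bfw t.
have [gsel gE] := bfw_search_ties bfw t.
(* The head is the draw of round [t]; [rev] restores the chronological order that the selectors
   expect. *)
exists (fun l => block_step (head finset.set0 l) (gsel (rev l))
  (phi (behead l)) (ssel (rev l))) => w.
rewrite (bfw_update bfw) past_history revK -past_history gE -phiE /=.
(* Blockwise, because [sE] speaks of drawn blocks only. *)
apply/mxrowP => n; rewrite !mxrowK; case: ifP => // nS.
by rewrite sE.
Qed.

Lemma iterate_descent t w eta (c : R) : (forall n, X n !=set0) ->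
  0 < eta -> eta <= 1 -> (set_curvature X f (draw t w) <= c%:E)%E ->
  f (x t.+1 w) <= f (x t w) - eta * (\sum_(n in draw t w) block_gap X f (x t w) n)
    + eta ^+ 2 / 2 * c.
Proof.
move=> X0 eta0 eta1 Cc.
have Xs n : n \in draw t w -> X n (s t w n) by move=> /(bfw_oracle bfw)[].
rewrite (bfw_update bfw) block_stepE.
have [_ /(_ eta)] := bfw_search bfw t w.
rewrite (ltW eta0) eta1 => /(_ isT) /le_trans -> //.
rewrite -block_stepE.
apply: le_trans (curvature_descent eta0 eta1 (iterate_feasible t w) Xs Cc) _.
rewrite lerD2r lerD2l lerN2 ler_pM2l //; apply: ler_sum => n nS.
by apply: block_gap_le => // z Xz; have [_] := bfw_oracle bfw nS; apply.
Qed.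

End Iterates.

Theorem theorem4 (R : realType)
  (N : nat) (dim : 'I_N -> nat) (B : nat)
  (hN : (1 <= N)%N) (hB : (1 <= B <= N)%N)
  (X : forall n : 'I_N, set 'rV[R]_(dim n))
  (hX0 : forall n, X n !=set0)
  (hXconv : forall n, convex_set (X n))
  (hXcomp : forall n, compact (X n))
  (f : 'rV[R]_(\sum_n dim n) -> R)
  (U : set 'rV[R]_(\sum_n dim n))
  (hUopen : open U) (hXU : feasible X `<=` U)
  (hf : forall x, U x -> differentiable f x)
  (xstar : 'rV[R]_(\sum_n dim n))
  (hxstar : feasible X xstar)
  (hmin : forall y, feasible X y -> f xstar <= f y)
  (hCf : set_curvature X f [set: 'I_N]%SET \is a fin_num)
  (disp : measure_display) (T : measurableType disp) (P : probability T R)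
  (draw : nat -> T -> {set 'I_N})
  (hunif : uniform_draws P draw B)
  (hindep : independent_draws P draw)
  (x0 : 'rV[R]_(\sum_n dim n)) (hx0 : feasible X x0)
  (s : nat -> T -> forall n : 'I_N, 'rV[R]_(dim n))
  (gamma : nat -> T -> R)
  (x : nat -> T -> 'rV[R]_(\sum_n dim n))
  (hbfw : block_frank_wolfe X f x0 draw s gamma x) :
  let alpha : R := B%:R / N%:R in
  let h := fun y => f y - f xstar in
  forall t : nat,
    (\big[mine/+oo]_(k < t.+1) 'E_P[fun w => duality_gap X f (x k w)] <=
     maxe (2 * h x0)%:E (expected_set_curvature X f B) *
       ((alpha * Num.sqrt t.+1%:R)^-1)%:E)%E.
Proof.
move=> alpha h t.
have X0 : feasible X !=set0 by exists x0.
have N0 : 0 < N%:R :> R by rewrite ltr0n.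
have alpha0 : 0 < alpha by rewrite divr_gt0 // ltr0n; case/andP: hB.
have BN : (B <= N)%N by case/andP: hB.
have [phi phiE] := iterate_past hbfw.
pose u : {set 'I_N} -> R := unif B.
pose c S := fine (set_curvature X f S).
pose a k := avg u k (fun l => f (phi l)).
pose G k := avg u k (fun l => duality_gap X f (phi l)).
have aE0 : a 0%N = f x0.
  (* [phi] is pinned down only at sample points, so one is extracted from the total mass 1 of
     [P]. *)
  have [w _] : [set: T] !=set0.
    apply/set0P/negP => /eqP T0; have := probability_setT P.
    by rewrite T0 measure0 => /eqP; rewrite lt_eqF // lte01.
  by rewrite /a avg0 -(bfw_init hbfw w) phiE.
have desc k eta : 0 < eta -> eta <= 1 ->
    a k.+1 <= a k - eta * (alpha * G k) + eta ^+ 2 / 2 * (\sum_S u S * c S).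
  move=> eta0 eta1.
  (* The one-step bound holds on realized histories only, so it is averaged over
     the histories of length k+1 before the last draw is summed out. *)
  pose H l := f (phi (behead l))
    - eta * (\sum_(n in head finset.set0 l) block_gap X f (phi (behead l)) n)
    + eta ^+ 2 / 2 * c (head finset.set0 l).
  apply: (@le_trans _ _ (avg u k.+1 H)).
    apply: (avg_le hunif hindep) => w; rewrite -phiE /H /= -phiE.
    apply: (iterate_descent hbfw) => //.
    by rewrite fineK // set_curvature_fin.
  (* Summing out the last draw: terms free of it keep mass 1, the block gaps gain the factor alpha,
     and the curvatures average to the expected one. *)
  have -> : avg u k.+1 H = avg u k (fun l => f (phi l) +
      (- (eta * alpha) * (\sum_n block_gap X f (phi l) n) +
      eta ^+ 2 / 2 * (\sum_S u S * c S))).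
    rewrite avgS; congr avg; apply/funext => l; rewrite /H /=.
    under eq_bigr do rewrite mulrDr mulrBr !(mulrCA (u _)).
    rewrite big_split sumrB -mulr_suml -!mulr_sumr sum_unif // mul1r.
    by rewrite sum_unif_blocks // addrA mulNr mulrA.
  (* The block gaps enter with a negative sign, so passing from their sum to the smaller duality gap
     only raises the bound. *)
  rewrite !avgD !avgZ (avg_cst hunif hindep) addrA lerD2r lerD2l mulNr lerN2 mulrA.
  rewrite (ler_pM2l (mulr_gt0 eta0 alpha0)); apply: (avg_le hunif hindep) => w.
  exact: duality_gap_le.
have fmin : f xstar <= a t.+1.
  rewrite -(avg_cst hunif hindep t.+1 (f xstar)).
  apply: (avg_le hunif hindep) => w; rewrite -phiE; apply: hmin.
  exact: (iterate_feasible hbfw).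
have [k Gk] := min_gap_bound alpha0 desc fmin.
rewrite (expected_set_curvatureE _ X0 hCf) -EFin_max -EFinM.
apply: le_trans (_ : ((G k)%:E <= _)%E); last by rewrite lee_fin /h -aE0.
have -> : (G k)%:E = ('E_P[fun w => duality_gap X f (x k w)])%E.
  rewrite /G -(expectation_past hunif hindep).
  by congr expectation; apply/funext => w; rewrite phiE.
by rewrite (bigD1 k) //= ge_min lexx.
Qed.
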